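(* For any non-trivial associative ring $R$, the following are equivalent: (1) Every Gorenstein projective $R$-module is Gorenstein flat. (2) $I^{+}\in\mathcal{GP}(R)^{\perp}$ for every injective right $R$-module $I$. (3) $F^{++}\in\mathcal{GP}(R)^{\perp}$ for every flat $R$-module $F$.
   Context: Modules are left unitary $R$-modules unless stated to be right modules. An $R$-module $M$ is Gorenstein projective if there is an exact sequence of projective $R$-modules $\mathbf{P}:\cdots\to P_1\to P_0\to P^0\to P^1\to\cdots$ with $M\cong \mathrm{Im}(P_0\to P^0)$ such that $\mathrm{Hom}_R(-,Q)$ leaves $\mathbf{P}$ exact for every projective module $Q$. $\mathcal{GP}(R)$ is the class of Gorenstein projective modules. An $R$-module $M$ is Gorenstein flat if there is an exact sequence of flat $R$-modules $\mathbf{F}:\cdots\to F_1\to F_0\to F^0\to F^1\to\cdots$ with $M\cong\mathrm{Im}(F_0\to F^0)$ such that $I\otimes_R-$ leaves $\mathbf{F}$ exact for every injective right $R$-module $I$. $\mathcal{GP}(R)^{\perp}=\{M\mid \mathrm{Ext}^1_R(G,M)=0\text{ for all }G\in\mathcal{GP}(R)\}$. $M^{+}=\mathrm{Hom}_{\mathbb{Z}}(M,\mathbb{Q}/\mathbb{Z})$ is the character module of $M$ (which exchanges left and right modules), and $M^{++}=(M^+)^+$. *)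

(* Defs.v *)
From HB Require Import structures.
From mathcomp Require Import all_boot all_order all_algebra ring_quotient.
From mathcomp Require Import boolp.
From mathcomp.multinomials Require Import freeg.

Set Implicit Arguments.
Unset Strict Implicit.
Unset Printing Implicit Defensive.

Import GRing.Theory.

Local Open Scope ring_scope.
Local Open Scope quotient_scope.

(* A left R-module is an [lmodType R].  A right R-module is an [lmodType R^c]
   over the converse ring: the right action x . r is [rscale x r]. *)
Definition rscale (R : nzRingType) (A : lmodType R^c) (x : A) (r : R) : A :=
  (r : R^c) *: x.

Lemma rscaleA (R : nzRingType) (A : lmodType R^c) (x : A) (r s : R) :
  rscale (rscale x r) s = rscale x (r * s).
Proof. by rewrite /rscale scalerA. Qed.

Section TensorProduct.
Variables (R : nzRingType) (A : lmodType R^c) (M : lmodType R).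

Local Notation F := {freeg (A * M)%type / int}.

(* The subgroup of the free abelian group on A * M spanned by the
   bilinearity and R-balancedness relations. *)
Inductive tensor_rel : F -> Prop :=
| TensorRel0 : tensor_rel 0
| TensorRelB x y : tensor_rel x -> tensor_rel y -> tensor_rel (x - y)
| TensorRelDl a a' m :
    tensor_rel (<< (a + a', m) >> - (<< (a, m) >> + << (a', m) >>))
| TensorRelDr a m m' :
    tensor_rel (<< (a, m + m') >> - (<< (a, m) >> + << (a, m') >>))
| TensorRelZ a r m : tensor_rel (<< (rscale a r, m) >> - << (a, r *: m) >>).

Definition tensor_relb : {pred F} := fun x => `[< tensor_rel x >].

Lemma tensor_relb_zmod : zmod_closed tensor_relb.
Proof.
split=> [|x y /asboolP hx /asboolP hy]; apply/asboolP.
  exact: TensorRel0.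
exact: TensorRelB.
Qed.

HB.instance Definition _ := GRing.isZmodClosed.Build F tensor_relb
  tensor_relb_zmod.

Definition tensor := Quotient.quot tensor_relb.
HB.instance Definition _ := GRing.Zmodule.on tensor.

Definition tensor_pi (x : F) : tensor := \pi_(Quotient.quot tensor_relb) x.

Definition tens (a : A) (m : M) : tensor := tensor_pi << (a, m) >>.

Lemma tensor_piB x y : tensor_pi (x - y) = tensor_pi x - tensor_pi y.
Proof. exact: raddfB. Qed.

Lemma tensor_piD x y : tensor_pi (x + y) = tensor_pi x + tensor_pi y.
Proof. exact: raddfD. Qed.

Lemma tensor_piP x y : tensor_pi x = tensor_pi y <-> tensor_rel (x - y).
Proof.
split=> [/eqP|h]; last apply/eqP; last by rewrite -Quotient.idealrBE; apply/asboolP.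
by rewrite -Quotient.idealrBE => /asboolP.
Qed.

Lemma tensDl a a' m : tens (a + a') m = tens a m + tens a' m.
Proof. by rewrite -tensor_piD; apply/tensor_piP/TensorRelDl. Qed.

Lemma tensDr a m m' : tens a (m + m') = tens a m + tens a m'.
Proof. by rewrite -tensor_piD; apply/tensor_piP/TensorRelDr. Qed.

Lemma tensZ a r m : tens (rscale a r) m = tens a (r *: m).
Proof. by apply/tensor_piP/TensorRelZ. Qed.

Section Lift.
Variables (G : zmodType) (phi : A -> M -> G).

Definition balanced :=
  [/\ forall a a' m, phi (a + a') m = phi a m + phi a' m,
      forall a m m', phi a (m + m') = phi a m + phi a m'
    & forall a r m, phi (rscale a r) m = phi a (r *: m)].

(* The additive extension of [phi] to formal sums, and the map it induces on
   the tensor product; the latter is meaningful when [phi] is balanced. *)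
Definition formal_lift (x : F) : G :=
  fglift (fun am => phi am.1 am.2 : zmodule G) x.

Definition tensor_lift (t : tensor) : G := formal_lift (repr t).

Lemma formal_liftB : zmod_morphism formal_lift.
Proof.
exact: (@lift_is_additive int (A * M)%type (zmodule G)
  (fun am => phi am.1 am.2)).
Qed.

HB.instance Definition _ := GRing.isZmodMorphism.Build F G formal_lift
  formal_liftB.

Lemma formal_liftU a m : formal_lift << (a, m) >> = phi a m.
Proof. by rewrite /formal_lift liftU /= scale1r. Qed.

Hypothesis phiP : balanced.

Lemma formal_lift_rel x : tensor_rel x -> formal_lift x = 0.
Proof.
case: phiP => hl hr hz; elim=> {x}.
- exact: raddf0.
- by move=> x y _ hx _ hy; rewrite formal_liftB hx hy subrr.
- by move=> *; rewrite raddfB raddfD /= !formal_liftU hl subrr.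
- by move=> *; rewrite raddfB raddfD /= !formal_liftU hr subrr.
- by move=> *; rewrite raddfB /= !formal_liftU hz subrr.
Qed.

Lemma tensor_lift_pi x : tensor_lift (tensor_pi x) = formal_lift x.
Proof.
apply/eqP; rewrite -subr_eq0 -formal_liftB; apply/eqP/formal_lift_rel.
by apply/tensor_piP; rewrite /tensor_pi reprK.
Qed.

Lemma tensor_liftB : zmod_morphism tensor_lift.
Proof.
move=> x y; rewrite -[x]reprK -[y]reprK -!/(tensor_pi _) -tensor_piB.
by rewrite !tensor_lift_pi formal_liftB.
Qed.

Lemma tensor_lift_tens a m : tensor_lift (tens a m) = phi a m.
Proof. by rewrite /tens tensor_lift_pi formal_liftU. Qed.

End Lift.

End TensorProduct.

Section TensorMap.
Variables (R : nzRingType) (A B : lmodType R^c) (M N : lmodType R).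
Variables (f : {linear A -> B}) (g : {linear M -> N}).

Lemma tensor_map_balanced : balanced (fun a m => tens (f a) (g m)).
Proof.
split=> [a a' m|a m m'|a r m]; rewrite ?linearD ?tensDl ?tensDr //.
by rewrite /rscale !linearZ /= -tensZ.
Qed.

Definition tensor_map : tensor A M -> tensor B N :=
  tensor_lift (fun a m => tens (f a) (g m)).

HB.instance Definition _ := GRing.isZmodMorphism.Build (tensor A M) (tensor B N)
  tensor_map (tensor_liftB tensor_map_balanced).

Lemma tensor_map_tens a m : tensor_map (tens a m) = tens (f a) (g m).
Proof. exact: (tensor_lift_tens tensor_map_balanced). Qed.

End TensorMap.

Definition rat_int : {pred rat} := fun x => x \is a Num.int.

Lemma rat_int_zmod : zmod_closed rat_int.
Proof. by split=> [|x y xZ yZ]; [exact: rpred0|exact: rpredB]. Qed.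

HB.instance Definition _ := GRing.isZmodClosed.Build rat rat_int rat_int_zmod.

Definition QmodZ := Quotient.quot rat_int.
HB.instance Definition _ := GRing.Zmodule.on QmodZ.


Section AdditiveZmodule.
Variables (U V : zmodType).
Implicit Types f g h : {additive U -> V}.

HB.instance Definition _ := gen_eqMixin {additive U -> V}.
HB.instance Definition _ := gen_choiceMixin {additive U -> V}.

Lemma additive_ext f g : f =1 g -> f = g.
Proof.
case: f g => [f [[fP]]] [g [[gP]]] /funext /= fg.
by rewrite {}fg in fP *; rewrite (Prop_irrelevance fP gP).
Qed.

Definition hom0 : {additive U -> V} := \0.
Definition homN f : {additive U -> V} := \- f.
Definition homD f g : {additive U -> V} := f \+ g.

Lemma homA : associative homD.
Proof. by move=> f g h; apply: additive_ext => x /=; rewrite addrA. Qed.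
Lemma homC : commutative homD.
Proof. by move=> f g; apply: additive_ext => x /=; rewrite addrC. Qed.
Lemma hom0D : left_id hom0 homD.
Proof. by move=> f; apply: additive_ext => x /=; rewrite add0r. Qed.
Lemma homND : left_inverse hom0 homN homD.
Proof. by move=> f; apply: additive_ext => x /=; rewrite addNr. Qed.

HB.instance Definition _ := GRing.isZmodule.Build {additive U -> V}
  homA homC hom0D homND.

End AdditiveZmodule.

Section CharacterLeft.
Variables (R : nzRingType) (M : lmodType R).

(* The character module of a left module is a right module:
   (phi . r) m = phi (r m). *)
Definition charL := {additive M -> QmodZ}.
Identity Coercion charL_additive : charL >-> GRing.Additive.type.
HB.instance Definition _ := GRing.Zmodule.on charL.

Definition charL_scale (r : R^c) (phi : charL) : charL :=
  phi \o ( *:%R (r : R)).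

Lemma charL_scaleA r s phi :
  charL_scale r (charL_scale s phi) = charL_scale (r * s) phi.
Proof. by apply: additive_ext => m /=; rewrite scalerA. Qed.
Lemma charL_scale1 : left_id 1 charL_scale.
Proof. by move=> phi; apply: additive_ext => m /=; rewrite scale1r. Qed.
Lemma charL_scaleDr : right_distributive charL_scale +%R.
Proof. by move=> r phi psi; apply: additive_ext. Qed.
Lemma charL_scaleDl phi : {morph charL_scale^~ phi : r s / r + s}.
Proof. by move=> r s; apply: additive_ext => m /=; rewrite scalerDl raddfD. Qed.

HB.instance Definition _ := GRing.Zmodule_isLmodule.Build R^c charL
  charL_scaleA charL_scale1 charL_scaleDr charL_scaleDl.

End CharacterLeft.

Section CharacterRight.
Variables (R : nzRingType) (A : lmodType R^c).

(* The character module of a right module is a left module: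
   (r phi) a = phi (a . r). *)
Definition charR := {additive A -> QmodZ}.
Identity Coercion charR_additive : charR >-> GRing.Additive.type.
HB.instance Definition _ := GRing.Zmodule.on charR.

Definition charR_scale (r : R) (phi : charR) : charR :=
  phi \o ( *:%R (r : R^c)).

Lemma charR_scaleE r phi a : charR_scale r phi a = phi (rscale a r).
Proof. by []. Qed.

Lemma charR_scaleA r s phi :
  charR_scale r (charR_scale s phi) = charR_scale (r * s) phi.
Proof. by apply: additive_ext => a; rewrite !charR_scaleE rscaleA. Qed.
Lemma charR_scale1 : left_id 1 charR_scale.
Proof. by move=> phi; apply: additive_ext => a /=; rewrite scale1r. Qed.
Lemma charR_scaleDr : right_distributive charR_scale +%R.
Proof. by move=> r phi psi; apply: additive_ext. Qed.
Lemma charR_scaleDl phi : {morph charR_scale^~ phi : r s / r + s}.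
Proof. by move=> r s; apply: additive_ext => a /=; rewrite scalerDl raddfD. Qed.

HB.instance Definition _ := GRing.Zmodule_isLmodule.Build R charR
  charR_scaleA charR_scale1 charR_scaleDr charR_scaleDl.

End CharacterRight.

Definition surjective (U V : Type) (f : U -> V) := forall v, exists u, f u = v.

(* Exactness of U -f-> V -g-> W at V. *)
Definition exact_at (U V W : zmodType) (f : U -> V) (g : V -> W) :=
  forall v, g v = 0 <-> exists u, f u = v.

(* Exactness at Hom_R(V, Q) of Hom_R(W, Q) -> Hom_R(V, Q) -> Hom_R(U, Q). *)
Definition hom_exact_at (R : nzRingType) (U V W : lmodType R)
    (f : {linear U -> V}) (g : {linear V -> W}) (Q : lmodType R) :=
  forall h : {linear V -> Q},
    (forall u, h (f u) = 0) <->
    exists k : {linear W -> Q}, forall v, k (g v) = h v.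

Section ModuleClasses.
Variable R : nzRingType.

Definition projective (P : lmodType R) :=
  forall (U V : lmodType R) (p : {linear U -> V}) (h : {linear P -> V}),
    surjective p -> exists k : {linear P -> U}, forall x, p (k x) = h x.

Definition injective_right (I : lmodType R^c) :=
  forall (U V : lmodType R^c) (i : {linear U -> V}) (h : {linear U -> I}),
    injective i -> exists k : {linear V -> I}, forall x, k (i x) = h x.

Definition flat (M : lmodType R) :=
  forall (A B : lmodType R^c) (i : {linear A -> B}),
    injective i -> injective (tensor_map i (idfun : {linear M -> M})).

(* An exact sequence indexed by int, with increasing differentials. *)
Record exact_complex := ExactComplex {
  ec_term :> int -> lmodType R;
  ec_diff : forall n : int, {linear ec_term n -> ec_term (n + 1)};
  ec_exact : forall n : int, exact_at (ec_diff n) (ec_diff (n + 1))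
}.

(* M is isomorphic to the image of f. *)
Definition iso_image (M U V : lmodType R) (f : {linear U -> V}) :=
  exists j : {linear M -> V},
    injective j /\ forall y, (exists m, j m = y) <-> exists x, f x = y.

(* In both definitions P_n is the term of index - n - 1 and P^n the term of
   index n, so that P_0 -> P^0 is the differential of index -1. *)
Definition Gorenstein_projective (M : lmodType R) :=
  exists P : exact_complex,
    [/\ forall n, projective (P n),
        iso_image M (ec_diff P (-1))
      & forall Q : lmodType R, projective Q ->
          forall n, hom_exact_at (ec_diff P n) (ec_diff P (n + 1)) Q].

Definition Gorenstein_flat (M : lmodType R) :=
  exists F : exact_complex,
    [/\ forall n, flat (F n),
        iso_image M (ec_diff F (-1))
      & forall I : lmodType R^c, injective_right I ->
          forall n, exact_at
            (tensor_map (idfun : {linear I -> I}) (ec_diff F n))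
            (tensor_map (idfun : {linear I -> I}) (ec_diff F (n + 1)))].

Record projective_resolution (G : lmodType R) := ProjectiveResolution {
  pr_term :> nat -> lmodType R;
  pr_diff : forall n : nat, {linear pr_term n.+1 -> pr_term n};
  pr_aug : {linear pr_term 0%N -> G};
  pr_proj : forall n, projective (pr_term n);
  pr_aug_surj : surjective pr_aug;
  pr_exact0 : exact_at (pr_diff 0%N) pr_aug;
  pr_exactS : forall n, exact_at (pr_diff n.+1) (pr_diff n)
}.

(* Ext^1_R(G, M) = 0: for a projective resolution P of G, the complex
   Hom_R(P, M) has trivial cohomology in degree 1.  By the comparison theorem
   this does not depend on P, so quantifying over all P is the same as fixing
   one; [projective_resolution_exists] shows that it is not vacuous. *)
Definition Ext1_eq0 (G M : lmodType R) :=
  forall P : projective_resolution G,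
    hom_exact_at (pr_diff P 1%N) (pr_diff P 0%N) M.

Definition GP_perp (M : lmodType R) :=
  forall G : lmodType R, Gorenstein_projective G -> Ext1_eq0 G M.

End ModuleClasses.

Section FreeModule.
Variables (R : nzRingType) (K : choiceType) (M : lmodType R) (f : K -> M).

Definition free_lift (x : {freeg K / R}) : M := fglift f x.

Lemma free_liftB : zmod_morphism free_lift.
Proof. exact: lift_is_additive. Qed.
HB.instance Definition _ :=
  GRing.isZmodMorphism.Build {freeg K / R} M free_lift free_liftB.

Lemma free_liftU k x : free_lift << k *g x >> = k *: f x.
Proof. exact: liftU. Qed.

Lemma free_ind (D : {freeg K / R}) (S : {freeg K / R} -> Prop) :
  S 0 -> (forall k x D, S D -> S (<< k *g x >> + D)) -> S D.
Proof.
move=> S0 SD; rewrite -[D]freeg_sumE; elim: (dom D) => [|x s IHs].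
  by rewrite big_nil.
by rewrite big_cons; apply: SD.
Qed.

Lemma freeU_scale (a k : R) (x : K) :
  a *: (<< k *g x >> : {freeg K / R}) = << (a * k) *g x >>.
Proof. by apply/eqP/freeg_eqP=> y; rewrite coeffZ !coeffU mulrA. Qed.

Lemma free_liftZ : scalable free_lift.
Proof.
move=> a; elim/free_ind => [|k x D IHD]; first by rewrite scaler0 !raddf0.
by rewrite scalerDr !raddfD /= IHD freeU_scale !free_liftU scalerA.
Qed.
HB.instance Definition _ :=
  GRing.isScalable.Build R {freeg K / R} M *:%R free_lift free_liftZ.

End FreeModule.

Lemma free_projective (R : nzRingType) (K : choiceType) :
  projective ({freeg K / R} : lmodType R).
Proof.
move=> U V p h ps; have [s sP] := choice (fun x : K => ps (h << x >>)).
exists (free_lift s) => D; elim/free_ind: D => [|k x D IHD].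
  by rewrite !linear0.
have -> : << k *g x >> = k *: << x >> :> {freeg K / R}.
  by rewrite freeU_scale mulr1.
by rewrite !linearD IHD !linearZ /= free_liftU scale1r sP.
Qed.

Section KernelModule.
Variables (R : nzRingType) (U V : lmodType R) (f : {linear U -> V}).

Definition kernel_pred : {pred U} := fun x => f x == 0.

Lemma ker_submod : submod_closed kernel_pred.
Proof.
split=> [|a x y /eqP fx /eqP fy]; apply/eqP; first exact: linear0.
by rewrite linearP fx fy scaler0 addr0.
Qed.

HB.instance Definition _ := GRing.isSubmodClosed.Build R U kernel_pred
  (GRing.submod_closed_semi ker_submod).

Record kernel := Kernel { ker_val : U; _ : ker_val \in kernel_pred }.
HB.instance Definition _ := [isSub for ker_val].
HB.instance Definition _ := [Choice of kernel by <:].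
HB.instance Definition _ := [SubChoice_isSubLmodule of kernel by <:].
End KernelModule.

Section Resolution.
Variables (R : nzRingType) (G : lmodType R).

Fixpoint syz n : lmodType R :=
  if n is n'.+1 then kernel (@free_lift R _ (syz n') id) else G.

Definition syz_cover n : {linear {freeg (syz n) / R} -> syz n} :=
  @free_lift R (syz n) (syz n) id.

Lemma syz_cover_surj n : surjective (syz_cover n).
Proof. by move=> x; exists << x >>; rewrite /syz_cover /= free_liftU scale1r. Qed.

Definition syz_incl n : {linear syz n.+1 -> {freeg (syz n) / R}} := val.

Lemma projective_resolution_exists : inhabited (projective_resolution G).
Proof.
have ex n : forall v, syz_cover n v = 0 <-> exists u, (syz_incl n \o syz_cover n.+1) u = v.
  move=> v; split=> [cv|[u <-]].
    have vP : v \in kernel_pred (syz_cover n) by apply/eqP.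
    have [u hu] := syz_cover_surj (Kernel vP : syz n.+1).
    by exists u; rewrite /= hu.
  by apply/eqP; apply: (valP (syz_cover n.+1 u : kernel _)).
have injI n : injective (syz_incl n) by apply: val_inj.
constructor; apply: (@ProjectiveResolution R G (fun n => {freeg (syz n) / R})
  (fun n => (syz_incl n \o syz_cover n.+1)) (syz_cover 0%N)).
- by move=> n; apply: free_projective.
- exact: syz_cover_surj.
- exact: ex.
- move=> n v; rewrite -(ex n.+1); split=> h.
    by apply: (injI n); rewrite linear0.
  by rewrite -(linear0 (syz_incl n)) -h.
Qed.

End Resolution.

(* Main.v *)
Require Import Defs.
From HB Require Import structures.
From mathcomp Require Import all_boot all_order all_algebra ring_quotient.
From mathcomp Require Import boolp classical_sets.
From mathcomp.multinomials Require Import freeg.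

Set Implicit Arguments.
Unset Strict Implicit.
Unset Printing Implicit Defensive.

Import Order.TTheory GRing.Theory Num.Theory.

Local Open Scope ring_scope.
Local Open Scope quotient_scope.

(** Everything is transported through characters.  Since Q/Z is an injective
    cogenerator and (A (x) M)^+ = Hom(M, A^+) = Hom(A, M^+), a complex
    I (x) P is exact iff Hom(P, I^+) is.

    (1) => (2): let F be a flat complex witnessing that G is Gorenstein flat,
    e : F_0 -> G the induced cover and P a projective resolution of G lifted
    along e.  Hom(-, I^+) is exact on extensions of F_0, because F_0^+ is
    injective, and on F, so a cocycle P_1 -> I^+ extends to P_0.

    (2) => (3): F^+ is injective when F is flat.

    (3) => (1): an injective I embeds in F^+ for any free cover F of I^+, hence
    is a retract of it, so I^+ is a retract of F^++ and (2) holds.  The cocycles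
    of a totally acyclic complex P are Gorenstein projective, so Hom(P, I^+) is
    exact; then so is I (x) P, and P itself is the required flat complex. *)

(** * The group Q/Z *)

Lemma QmodZ_pi_eq0 (q : rat) : (\pi_QmodZ q == 0) = (q \is a Num.int).
Proof.
have -> : (0 : QmodZ) = \pi_QmodZ 0 by rewrite raddf0.
by rewrite -Quotient.idealrBE subr0.
Qed.

(* [y != 0] is what makes characters separate points when [c = 0]. *)
Lemma QmodZ_div_neq0 (n : nat) (c : QmodZ) :
  (1 < n)%N -> exists2 y : QmodZ, y != 0 & y *+ n = c.
Proof.
move=> n1; have n0 : n%:R != 0 :> rat by rewrite pnatr_eq0 -lt0n ltnW.
have [->|cN0] := eqVneq c 0.
  exists (\pi_QmodZ n%:R^-1).
    rewrite QmodZ_pi_eq0; apply/negP => /intrP[z zE].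
    have z0 : 0 < z by rewrite -(ltr0z rat) -zE invr_gt0 ltr0n ltnW.
    have : (z%:~R < 1 :> rat) by rewrite -zE invf_lt1 ?ltr1n// ltr0n ltnW.
    by rewrite ltrz1 ltNge -gtz0_ge1 z0.
  by apply/eqP; rewrite -raddfMn /= -[_^-1 *+ _]mulr_natr mulVf// QmodZ_pi_eq0 rpred1.
exists (\pi_QmodZ (repr c / n%:R)).
  apply: contraNneq cN0 => y0.
  by rewrite -[c]reprK -[repr c](divfK n0) mulr_natr raddfMn /= y0 mul0rn.
by rewrite -raddfMn /= -[_ / _ *+ _]mulr_natr divfK// reprK.
Qed.


Lemma additive_pack (U V : zmodType) (f : U -> V) :
  zmod_morphism f -> exists g : {additive U -> V}, g =1 f.
Proof.
move=> fB; pose g : {additive U -> V} :=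
  HB.pack f (GRing.isZmodMorphism.Build U V f fB).
by exists g.
Qed.

(** * Extension of homomorphisms into Q/Z *)

Section Graphs.
Variable A : zmodType.
Implicit Types S : A -> QmodZ -> Prop.

(* Graphs of homomorphisms to Q/Z defined on a subgroup of [A]. *)
Definition zgraph S :=
  [/\ S 0 0,
      forall a b a' b', S a b -> S a' b' -> S (a - a') (b - b')
    & forall b, S 0 b -> b = 0].

Lemma zgraphN S a b : zgraph S -> S a b -> S (- a) (- b).
Proof. by case=> S0 SB _ /(SB _ _ _ _ S0); rewrite !sub0r. Qed.

Lemma zgraphD S a b a' b' :
  zgraph S -> S a b -> S a' b' -> S (a + a') (b + b').
Proof.
move=> gS Sab /(zgraphN gS); have [_ SB _] := gS.
by move=> /(SB _ _ _ _ Sab); rewrite !opprK.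
Qed.

Lemma zgraph_fun S a b b' : zgraph S -> S a b -> S a b' -> b = b'.
Proof.
case=> _ SB S0 Sb Sb'; apply/eqP; rewrite -subr_eq0; apply/eqP/S0.
by rewrite -(subrr a); apply: SB.
Qed.

Lemma zgraphMn S a b n : zgraph S -> S a b -> S (a *+ n) (b *+ n).
Proof.
move=> gS Sab; elim: n => [|n IHn]; first by rewrite !mulr0n; case: gS.
by rewrite !mulrS; apply: zgraphD.
Qed.

Lemma zgraphMz S a b k : zgraph S -> S a b -> S (a *~ k) (b *~ k).
Proof.
by move=> gS Sab; case: k => n; [|rewrite !NegzE !mulrNz; apply: (zgraphN gS)];
  rewrite -!pmulrn; apply: zgraphMn.
Qed.

(** If no positive multiple of [v] is in the domain, any nonzero [y] works; otherwise take [y] with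
    [y *+ d = c], where [c] is the value at the least such multiple [v *+ d]. As [d > 1], [y] can be
    nonzero. *)
Lemma zgraph_adjoin S v : zgraph S -> (forall b, ~ S v b) ->
  exists2 y, y != 0 &
    zgraph (fun a b => exists k : int, S (a - v *~ k) (b - y *~ k)).
Proof.
move=> gS vNS; have [S0 SB _] := gS.
(* The new graph is single-valued at 0 once [y] agrees with [S] on the multiples of [v] in its
   domain. *)
suff [y yN0 yP] : exists2 y, y != 0 &
    forall k : int, forall b, S (v *~ k) b -> b = y *~ k.
  exists y => //; split.
  - by exists 0; rewrite !mulr0z !subr0.
  - move=> a b a' b' [k Sk] [l Sl]; exists (k - l).
    have subACA (U : zmodType) (x z t u : U) : x - z - (t - u) = x - t - (z - u).
      by rewrite !opprB addrACA [in RHS]addrACA [- z - t]addrC.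
    by rewrite !mulrzBr !(subACA _ _ _ (_ *~ k)); apply: SB.
  - move=> b [k]; rewrite sub0r => /(zgraphN gS); rewrite opprK => /yP/eqP.
    by rewrite opprB -[X in _ == X]subr0 (inj_eq (addrI _)) eqr_opp => /eqP.
pose E n := `[< (0 < n)%N /\ exists b, S (v *+ n) b >].
have [exE|NE] := pselect (exists n, E n); last first.
  have [y yN0 _] := @QmodZ_div_neq0 2 0 isT; exists y => //.
  have NS n b : ~ S (v *+ n.+1) b.
    by move=> Sb; apply: NE; exists n.+1; apply/asboolP; split=> //; exists b.
  have [_ _ Sfun] := gS; case=> [[|n]|n] b.
  + by rewrite !mulr0z; apply: Sfun.
  + by rewrite -pmulrn => /NS.
  + by rewrite NegzE mulrNz -pmulrn => /(zgraphN gS); rewrite opprK => /NS.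
case: (ex_minnP exE) => d /asboolP[d0 [c Sc]] dmin.
have d1 : (1 < d)%N.
  by case: d d0 Sc {dmin} => [|[|d]]//= _; rewrite mulr1n => /vNS.
have [y yN0 yd] := QmodZ_div_neq0 c d1; exists y => // k b Sb.
(* The remainder of [k] modulo [d] also gives a multiple in the domain, so it is 0 by minimality of
   [d]. *)
have dk : (k = (k %/ d)%Z * d + `|(k %% d)%Z|%N)%R.
  by rewrite gez0_abs ?modz_ge0 -?divz_eq// -lt0n.
have Sr : exists b', S (v *+ `|(k %% d)%Z|%N) b'.
  exists (b - c *~ (k %/ d)%Z).
  have -> : v *+ `|(k %% d)%Z|%N = v *~ k - v *+ d *~ (k %/ d)%Z.
    rewrite pmulrn [in RHS]pmulrn -mulrzA -mulrzBr; congr (_ *~ _).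
    by rewrite {2}dk mulrC addrC addKr.
  by apply: SB => //; apply: zgraphMz.
have r0 : (`|(k %% d)%Z| = 0)%N.
  apply: contraTeq isT; rewrite -lt0n => r0.
  have /dmin : E `|(k %% d)%Z|%N by apply/asboolP.
  by rewrite -lez_nat gez0_abs ?modz_ge0 -?lt0n// leNgt ltz_pmod.
rewrite dk r0 addr0 mulrC !mulrzA -!pmulrn yd.
apply: (zgraph_fun gS Sb); rewrite {1}dk r0 addr0 mulrC mulrzA -pmulrn.
exact: zgraphMz.
Qed.

(** Zorn's lemma: the union bounds a nonempty chain, and [zgraph_adjoin] would enlarge a maximal
    graph that is not total. *)
Lemma zgraph_extend S : zgraph S ->
  exists f : {additive A -> QmodZ}, forall a b, S a b -> f a = b.
Proof.
move=> gS; pose T := {X : A -> QmodZ -> Prop |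
  zgraph X /\ forall a b, S a b -> X a b}.
pose leT := [rel X Y : T | `[< forall a b, sval X a b -> sval Y a b >]].
pose T0 : T := exist _ S (conj gS (fun _ _ => id)).
have [||C Ctot|[X [gX SX]] Xmax] := @ZL_preorder T T0 leT.
- by move=> X; apply/asboolP.
- move=> Y X Z /asboolP XY /asboolP YZ; apply/asboolP => a b.
  by move=> /XY/YZ.
- have [[X0 CX0]|NC] := pselect (exists X, C X); last first.
    by exists T0 => X CX; case: NC; exists X.
  pose U a b := exists2 X, C X & sval X a b.
  have gU : zgraph U /\ forall a b, S a b -> U a b.
    split=> [|a b Sab]; last by exists X0 => //; case: (svalP X0) => _; apply.
    split.
    - by exists X0 => //; case: (svalP X0) => [[]].
    - move=> a b a' b' [X CX Xab] [Y CY Yab].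
      have [/asboolP XY|/asboolP YX] := Ctot _ _ CX CY.
        exists Y => //; have [[_ YB _] _] := svalP Y.
        by apply: YB => //; apply: XY.
      exists X => //; have [[_ XB _] _] := svalP X.
      by apply: XB => //; apply: YX.
    - by move=> b [X CX]; case: (svalP X) => [[_ _ X0b] _]; apply: X0b.
  by exists (exist _ U gU) => X CX; apply/asboolP => a b Xab; exists X.
have Xtot v : exists b, X v b.
  apply: contrapT => NX; have vNX b : ~ X v b by move=> Xb; apply: NX; exists b.
  have [y _ gY] := zgraph_adjoin gX vNX.
  have XY a b : X a b -> exists k : int, X (a - v *~ k) (b - y *~ k).
    by exists 0; rewrite !mulr0z !subr0.
  pose Y : T := exist _ _ (conj gY (fun a b Sab => XY a b (SX a b Sab))).
  have /asboolP/(_ v y) := Xmax Y (asboolT XY).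
  move=> h; apply: (vNX y); apply: h; exists 1; rewrite !mulr1z !subrr.
  by have [] := gX.
have [f fX] := choice Xtot.
have fB : zmod_morphism f.
  move=> a b; apply: (zgraph_fun gX (fX _)).
  by have [_ XB _] := gX; apply: XB.
have [g gE] := additive_pack fB.
by exists g => a b /SX; rewrite gE; apply: zgraph_fun.
Qed.

End Graphs.

(** The pairs [(i a, h a)] form a graph because [h] kills [ker i]. Besides extensions along
    injections, this gives factorizations through surjections. *)
Lemma QmodZ_extend (A B : zmodType) (i : {additive A -> B})
    (h : {additive A -> QmodZ}) : (forall a, i a = 0 -> h a = 0) ->
  exists k : {additive B -> QmodZ}, forall a, k (i a) = h a.
Proof.
move=> ih; have [|k kP] := @zgraph_extend B (fun b q => exists a, b = i a /\ q = h a).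
  split=> [|_ _ _ _ [a [-> ->]] [a' [-> ->]]|_ [a [/esym/ih ha ->]]//].
    by exists 0; rewrite !raddf0.
  by exists (a - a'); rewrite !raddfB.
by exists k => a; apply: kP; exists a.
Qed.

(** Extend the zero map on the image of [i] by a nonzero value at [v]. *)
Lemma QmodZ_separate (A B : zmodType) (i : {additive A -> B}) (v : B) :
  (forall a, i a <> v) ->
  exists2 k : {additive B -> QmodZ}, forall a, k (i a) = 0 & k v <> 0.
Proof.
move=> iNv; pose S b q := (exists a, i a = b) /\ q = 0 :> QmodZ.
have gS : zgraph S.
  split=> [|_ _ _ _ [[a <-] ->] [[a' <-] ->]|_ [_ ->]//].
    by split=> //; exists 0; rewrite raddf0.
  by split; rewrite ?subr0//; exists (a - a'); rewrite raddfB.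
have [_ [[a /iNv]]//|y /eqP yN0 gY] := zgraph_adjoin gS (v := v).
have [k kP] := zgraph_extend gY; exists k => [a|].
  by apply: kP; exists 0; rewrite !mulr0z !subr0; split=> //; exists a.
suff -> : k v = y by [].
by apply: kP; exists 1; rewrite !mulr1z !subrr; case: gS.
Qed.

Lemma QmodZ_separate0 (B : zmodType) (v : B) :
  v != 0 -> exists k : {additive B -> QmodZ}, k v <> 0.
Proof.
move=> vN0; have [|k _ kv] := @QmodZ_separate B B \0 v; last by exists k.
by move=> a /esym/eqP; apply/negP.
Qed.

(** * Characters of tensor products *)

Lemma linear_pack (R : nzRingType) (U V : lmodType R) (f : U -> V) :
  linear f -> exists g : {linear U -> V}, g =1 f.
Proof.
move=> fL; pose g : {linear U -> V} :=
  HB.pack f (GRing.isLinear.Build R U V *:%R f fL).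
by exists g.
Qed.

Lemma linear_of_graph (R : nzRingType) (U V : lmodType R) (S : U -> V -> Prop) :
  (forall u, exists v, S u v) ->
  (forall a u v u' v', S u v -> S u' v' -> S (a *: u + u') (a *: v + v')) ->
  (forall u v v', S u v -> S u v' -> v = v') ->
  exists f : {linear U -> V}, forall u, S u (f u).
Proof.
move=> Stot SL Sfun; have [f fS] := choice Stot.
have [|g gf] := @linear_pack R U V f; last by exists g => u; rewrite gf.
by move=> a u u'; apply: Sfun (fS _) _; apply: SL.
Qed.

Section Adjunction.
Variables (R : nzRingType) (A : lmodType R^c) (M : lmodType R).

Lemma tensor_ext (G : zmodType) (f g : {additive tensor A M -> G}) :
  (forall a m, f (tens a m) = g (tens a m)) -> f =1 g.
Proof.
move=> fg t; rewrite -[t]reprK -/(tensor_pi _).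
rewrite -[repr t]freeg_sumE; elim: (dom _) => [|x s IHs].
  by rewrite big_nil /tensor_pi !raddf0.
rewrite big_cons tensor_piD !raddfD IHs; congr (_ + _).
case: x {IHs} => a m; set k := coeff _ _.
have -> : << k *g (a, m) >> = << (a, m) >> *~ k :> {freeg (A * M)%type / int}.
  by rewrite -scaler_int freeU_scale mulr1 intz.
have [p pE] := additive_pack (@tensor_piB R A M).
by rewrite -pE raddfMz pE -/(tens a m) !raddfMz fg.
Qed.

Lemma tensor_char (phi : A -> M -> QmodZ) : balanced phi ->
  exists chi : {additive tensor A M -> QmodZ},
    forall a m, chi (tens a m) = phi a m.
Proof.
move=> phiP; have [chi chiE] := additive_pack (tensor_liftB phiP).
by exists chi => a m; rewrite chiE tensor_lift_tens.
Qed.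

(** This lemma and the next three pass between characters of [A (x) M], maps [M -> A^+] and maps
    [A -> M^+]. *)
Lemma homL_char (h : {linear M -> charR A}) :
  exists chi : {additive tensor A M -> QmodZ},
    forall a m, chi (tens a m) = h m a.
Proof.
apply: (@tensor_char (fun a m => h m a)).
by split=> [a a' m|a m m'|a r m]; rewrite ?raddfD// linearZ.
Qed.

Lemma homR_char (h : {linear A -> charL M}) :
  exists chi : {additive tensor A M -> QmodZ},
    forall a m, chi (tens a m) = h a m.
Proof.
apply: (@tensor_char (fun a m => h a m)).
by split=> [a a' m|a m m'|a r m]; rewrite ?raddfD// /rscale linearZ.
Qed.

Lemma char_homL (chi : {additive tensor A M -> QmodZ}) :
  exists h : {linear M -> charR A}, forall a m, h m a = chi (tens a m).
Proof.
have /choice[h hP] m : exists k : charR A, forall a, k a = chi (tens a m).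
  have [|k kE] := @additive_pack A QmodZ (fun a => chi (tens a m));
    last by exists k.
  by move=> a a'; rewrite -raddfB -[in RHS](addrNK a' a) [in RHS]tensDl addrK.
have [|g gE] := @linear_pack R M (charR A) h;
  last by exists g => a m; rewrite gE hP.
move=> r m m'; apply: additive_ext => a.
by rewrite /= !hP tensDr raddfD -tensZ.
Qed.

Lemma char_homR (chi : {additive tensor A M -> QmodZ}) :
  exists h : {linear A -> charL M}, forall a m, h a m = chi (tens a m).
Proof.
have /choice[h hP] a : exists k : charL M, forall m, k m = chi (tens a m).
  have [|k kE] := @additive_pack M QmodZ (fun m => chi (tens a m));
    last by exists k.
  by move=> m m'; rewrite -raddfB -[in RHS](addrNK m' m) [in RHS]tensDr addrK.
have [|g gE] := @linear_pack R^c A (charL M) h;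
  last by exists g => a m; rewrite gE hP.
move=> r a a'; apply: additive_ext => m.
by rewrite /= !hP tensDl raddfD -/(rscale a r) tensZ.
Qed.

Lemma hom_swapLR (h : {linear M -> charR A}) :
  exists k : {linear A -> charL M}, forall a m, k a m = h m a.
Proof.
have [chi chiE] := homL_char h; have [k kE] := char_homR chi.
by exists k => a m; rewrite kE chiE.
Qed.

Lemma hom_swapRL (h : {linear A -> charL M}) :
  exists k : {linear M -> charR A}, forall a m, k m a = h a m.
Proof.
have [chi chiE] := homR_char h; have [k kE] := char_homL chi.
by exists k => a m; rewrite kE chiE.
Qed.
End Adjunction.

(** * Flat, projective and injective modules through characters *)

Lemma char_dualL (R : nzRingType) (M N : lmodType R) (f : {linear M -> N}) :
  exists g : {linear charL N -> charL M}, forall k m, g k m = k (f m).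
Proof.
have [|g gE] := @linear_pack R^c (charL N) (charL M) (fun k => k \o f).
  by move=> r k k'; apply: additive_ext => m /=; rewrite linearZ.
by exists g => k m; rewrite gE.
Qed.

Lemma char_dualR (R : nzRingType) (A B : lmodType R^c) (f : {linear A -> B}) :
  exists g : {linear charR B -> charR A}, forall k a, g k a = k (f a).
Proof.
have [|g gE] := @linear_pack R (charR B) (charR A) (fun k => k \o f).
  by move=> r k k'; apply: additive_ext => a /=; rewrite linearZ.
by exists g => k a; rewrite gE.
Qed.

(** A map [A -> F^+] is a character of [A (x) F], and it extends along the injection [i (x) F]. *)
Lemma flat_charL_injective (R : nzRingType) (F : lmodType R) :
  flat F -> injective_right (charL F).
Proof.
move=> flF A B i h iI; have [chi chiE] := homR_char h.
have iFI := flF A B i iI.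
have [|psi psiE] := @QmodZ_extend _ _ (tensor_map i (idfun : {linear F -> F})) chi.
  by move=> t t0; rewrite -(raddf0 chi); congr (chi _); apply: iFI;
    rewrite t0 raddf0.
have [k kE] := char_homR psi; exists k => a; apply: additive_ext => m.
by rewrite kE -chiE -psiE /= tensor_map_tens.
Qed.

Lemma injective_raddf (U V : zmodType) (f : {additive U -> V}) :
  (forall u, f u = 0 -> u = 0) -> injective f.
Proof.
move=> f0 u u' ff; apply/eqP; rewrite -subr_eq0; apply/eqP/f0.
by rewrite raddfB ff subrr.
Qed.

(** A character of [A (x) P] is a map [P -> A^+]. Lifting it through the surjection [B^+ -> A^+]
    factors the character through [i (x) P], so all characters vanish on the kernel of [i (x) P]. *)
Lemma projective_flat (R : nzRingType) (P : lmodType R) :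
  projective P -> flat P.
Proof.
move=> prP A B i iI; apply: injective_raddf => t t0; apply: contrapT => /eqP tN0.
have [chi chit] := QmodZ_separate0 tN0; apply: chit.
have [h hE] := char_homL chi; have [ci ciE] := char_dualR i.
have [|k kE] := prP _ _ ci h.
  move=> v; have [|w wE] := @QmodZ_extend _ _ i v.
    by move=> a a0; rewrite -(raddf0 v); congr (v _); apply: iI;
      rewrite a0 raddf0.
  by exists w; apply: additive_ext => a; rewrite ciE wE.
have [psi psiE] := homL_char k.
suff -> : chi t = (psi \o tensor_map i (idfun : {linear P -> P})) t.
  by rewrite /= t0 raddf0.
apply: tensor_ext => a m /=.
by rewrite tensor_map_tens psiE -hE -kE ciE.
Qed.

(** The transpose [c] of a free cover of [I^+] is injective, since [c x = 0] means that every
    character of [I] kills [x]; injectivity of [I] splits it. *)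
Lemma injective_right_retract_charL (R : nzRingType) (I : lmodType R^c) :
  injective_right I -> exists (F : lmodType R) (c : {linear I -> charL F})
    (r : {linear charL F -> I}), flat F /\ forall x, r (c x) = x.
Proof.
move=> injI; pose F : lmodType R := {freeg (charR I) / R}.
pose q : {linear F -> charR I} := @free_lift R (charR I) (charR I) id.
have [c cE] := hom_swapLR q.
have cI : injective c.
  apply: injective_raddf => x cx; apply: contrapT => /eqP xN0.
  have [k kx] := QmodZ_separate0 xN0; apply: kx.
  have -> : k = q << (k : charR I) >> by rewrite /q /= free_liftU scale1r.
  by rewrite -cE cx.
have [r rE] := injI _ _ c idfun cI.
by exists F, c, r; split=> [|x]; [apply/projective_flat/free_projective|rewrite rE].
Qed.

Lemma Ext1_eq0_retract (R : nzRingType) (G M N : lmodType R)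
    (s : {linear M -> N}) (r : {linear N -> M}) :
  (forall x, r (s x) = x) -> Ext1_eq0 G N -> Ext1_eq0 G M.
Proof.
move=> rs ext P h; split=> [hd|[k kh] u].
  have /(ext P (s \o h))[k kE] : forall u, (s \o h) (pr_diff P 1 u) = 0.
    by move=> u /=; rewrite hd raddf0.
  by exists (r \o k) => v /=; rewrite kE /= rs.
rewrite -kh; suff -> : pr_diff P 0 (pr_diff P 1 u) = 0 by rewrite raddf0.
by apply/pr_exactS; exists u.
Qed.

Lemma GP_perp_charR (R : nzRingType) :
  (forall F : lmodType R, flat F -> GP_perp (charR (charL F))) ->
  forall I : lmodType R^c, injective_right I -> GP_perp (charR I).
Proof.
move=> perpF I /injective_right_retract_charL[F [c [r [flF rc]]]] G GP.
have [rd rdE] := char_dualR r; have [cd cdE] := char_dualR c.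
(* Dualizing swaps the roles: [r^+] is the section and [c^+] the retraction. *)
apply: (Ext1_eq0_retract (s := rd) (r := cd)) (perpF _ flF _ GP) => x.
by apply: additive_ext => a; rewrite cdE rdE rc.
Qed.

(** * Complexes and extensions *)

(** [Hom(-, I^+)] is the character dual of [I (x) -]. Dualizing preserves exactness as Q/Z is
    injective, and reflects it as characters separate points from subgroups. *)
Lemma tensor_exact_hom (R : nzRingType) (I : lmodType R^c) (U V W : lmodType R)
    (f : {linear U -> V}) (g : {linear V -> W}) :
  exact_at (tensor_map (idfun : {linear I -> I}) f)
           (tensor_map (idfun : {linear I -> I}) g) <->
  hom_exact_at f g (charR I).
Proof.
set tf := tensor_map _ f; set tg := tensor_map _ g.
split=> [tfg h|homfg v].
  have [chi chiE] := homL_char h; split=> [hf|[k kE] u].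
    have chif s : chi (tf s) = 0.
      have -> : chi (tf s) = (chi \o tf) s by [].
      have -> : 0 = (\0 : {additive tensor I U -> QmodZ}) s by [].
      by apply: tensor_ext => a u /=; rewrite tensor_map_tens chiE hf.
    have [|psi psiE] := @QmodZ_extend _ _ tg chi.
      by move=> t /tfg[s <-].
    have [k kE] := char_homL psi; exists k => v; apply: additive_ext => a.
    by rewrite kE -chiE -psiE /= tensor_map_tens.
  apply: additive_ext => a; rewrite -kE /=.
  have [psi psiE] := homL_char k.
  rewrite -psiE; have -> : tens a (g (f u)) = tg (tf (tens a u)).
    by rewrite /tf /tg /= !tensor_map_tens.
  by rewrite (_ : tg _ = 0) ?raddf0//; apply/tfg; exists (tens a u).
split=> [tgv|[u <-]].
  apply: contrapT => vNf; have [|chi chif chiv] := @QmodZ_separate _ _ tf v.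
    by move=> u uv; apply: vNf; exists u.
  have [h hE] := char_homL chi.
  have /homfg[k kE] u : h (f u) = 0.
    by apply: additive_ext => a; rewrite hE -[tens _ _](tensor_map_tens idfun) chif.
  have [psi psiE] := homL_char k; apply: chiv.
  suff -> : chi v = (psi \o tg) v by rewrite /= tgv raddf0.
  by apply: tensor_ext => a m /=; rewrite tensor_map_tens psiE kE hE.
apply: contrapT => /eqP/QmodZ_separate0[chi]; apply.
have [k kE] := char_homL chi.
have kgf : forall u, (k \o g) (f u) = 0 by apply/homfg; exists k.
have -> : chi (tg (tf u)) = (chi \o (tg \o tf)) u by [].
have -> : 0 = (\0 : {additive tensor I U -> QmodZ}) u by [].
apply: tensor_ext => a m /=; rewrite !tensor_map_tens -kE.
by rewrite [k _]kgf.
Qed.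

(** * Shifted complexes and their modules of cocycles *)

Section Shift.
Variables (R : nzRingType) (P : exact_complex R).

(* Indices such as [n + s + 1] and [n + 1 + s] are equal, not convertible. *)
Definition ec_cast (a b : int) (e : a + 1 = b) : {linear P a -> P b} :=
  match e in _ = b return {linear P a -> P b} with erefl => ec_diff P a end.

Lemma ec_cast_exact a b c (e1 : a + 1 = b) (e2 : b + 1 = c) :
  exact_at (ec_cast e1) (ec_cast e2).
Proof. by case: _ / e2; case: _ / e1; apply: ec_exact. Qed.

Lemma ec_cast_hom_exact (Q : lmodType R) :
  (forall n, hom_exact_at (ec_diff P n) (ec_diff P (n + 1)) Q) ->
  forall a b c (e1 : a + 1 = b) (e2 : b + 1 = c),
    hom_exact_at (ec_cast e1) (ec_cast e2) Q.
Proof. by move=> PQ a b c e1 e2; case: _ / e2; case: _ / e1; apply: PQ. Qed.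

Lemma hom_exact_of_ec_cast (Q : lmodType R) a b c (e1 : a + 1 = b)
    (e2 : b + 1 = c) n (na : a = n) : hom_exact_at (ec_cast e1) (ec_cast e2) Q ->
  hom_exact_at (ec_diff P n) (ec_diff P (n + 1)) Q.
Proof. by case: _ / na; case: _ / e2; case: _ / e1. Qed.

Lemma shift_index (s n : int) : n + s + 1 = n + 1 + s.
Proof. by rewrite addrAC. Qed.

Definition ec_shift (s : int) : exact_complex R :=
  @ExactComplex R (fun n => P (n + s)) (fun n => ec_cast (shift_index s n))
    (fun n => ec_cast_exact (shift_index s n) (shift_index s (n + 1))).

(** The shift by [s] turns these cocycles into the image of the differential of index [-1]; the form
    [-1 + 1 + s] of the index avoids a cast. *)
Lemma cocycles_Gorenstein_projective s :
  (forall n, projective (P n)) ->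
  (forall Q : lmodType R, projective Q ->
     forall n, hom_exact_at (ec_diff P n) (ec_diff P (n + 1)) Q) ->
  Gorenstein_projective (kernel (ec_diff P (-1 + 1 + s)) : lmodType R).
Proof.
move=> prP homP; exists (ec_shift s); split=> [n||Q prQ n]; first exact: prP.
  exists (val : {linear kernel (ec_diff P (-1 + 1 + s)) -> P (-1 + 1 + s)}).
  split=> [|y]; first exact: val_inj.
  have ex := ec_cast_exact (shift_index s (-1)) (erefl (-1 + 1 + s + 1)) y.
  split=> [[m my]|/(proj2 ex)/eqP y0].
    by apply: (proj1 ex); rewrite -my; apply/eqP; apply: (valP m).
  by exists (Kernel (y0 : y \in kernel_pred (ec_diff P (-1 + 1 + s)))).
exact: (ec_cast_hom_exact (homP Q prQ)).
Qed.

Lemma res_index (s : int) (k : nat) : s - k.+2%:Z + 1 = s - k.+1%:Z.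
Proof. by rewrite -addrA -[k.+2]addn1 PoszD opprD addrNK. Qed.

Lemma aug_index (s : int) : s - 1%:Z + 1 = s.
Proof. by rewrite subrK. Qed.

(** The part of [P] left of [s] resolves the cocycles at [s], with the term of index [s - k - 1] in
    degree [k]. *)
Lemma cocycles_resolution s : (forall n, projective (P n)) ->
  exists X : projective_resolution (kernel (ec_diff P s) : lmodType R),
    forall Q, hom_exact_at (pr_diff X 1%N) (pr_diff X 0%N) Q ->
      hom_exact_at (ec_cast (res_index s 1)) (ec_cast (res_index s 0)) Q.
Proof.
move=> prP; pose N := kernel (ec_diff P s).
pose incl : {linear N -> P s} := val.
have exs := ec_cast_exact (aug_index s) (erefl (s + 1)).
have [aug augE] : exists aug : {linear P (s - 1%:Z) -> N},
    forall x, incl (aug x) = ec_cast (aug_index s) x.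
  apply: (@linear_of_graph R _ N (fun x y => incl y = ec_cast (aug_index s) x)).
  - move=> x; have /eqP y0 : ec_diff P s (ec_cast (aug_index s) x) = 0.
      by apply/exs; exists x.
    by exists (Kernel (y0 : _ \in kernel_pred (ec_diff P s))).
  - by move=> a u v u' v' uv uv'; rewrite !linearP uv uv'.
  - by move=> u v v' uv uv'; apply: val_inj; rewrite [LHS]uv [RHS]uv'.
unshelve eexists.
  apply: (@ProjectiveResolution R N (fun k => P (s - k.+1%:Z))
    (fun k => ec_cast (res_index s k)) aug).
  - by move=> n; apply: prP.
  - move=> y; have /exs[x xE] : ec_diff P s (incl y) = 0.
      by apply/eqP; apply: (valP y).
    by exists x; apply: val_inj; rewrite [LHS]augE.
  - have ex0 := ec_cast_exact (res_index s 0) (aug_index s).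
    move=> v; rewrite -(ex0 v) -augE; split=> [->|h]; first by rewrite raddf0.
    by apply: val_inj; rewrite [LHS]h.
  - by move=> n; apply: ec_cast_exact.
by [].
Qed.

Lemma GP_perp_hom_exact (Q : lmodType R) :
  (forall n, projective (P n)) ->
  (forall Q : lmodType R, projective Q ->
     forall n, hom_exact_at (ec_diff P n) (ec_diff P (n + 1)) Q) ->
  GP_perp Q -> forall n, hom_exact_at (ec_diff P n) (ec_diff P (n + 1)) Q.
Proof.
(* Degree 1 of the resolution of the cocycles at [s] has index [s - 2], and exactness is wanted at
   [n + 1]. *)
move=> prP homP perpQ n; pose s := n + 3%:Z.
have GPN := cocycles_Gorenstein_projective s prP homP.
have [X XQ] := cocycles_resolution (-1 + 1 + s) prP.
apply: hom_exact_of_ec_cast (XQ Q (perpQ _ GPN X)).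
by rewrite addNr add0r /s addrK.
Qed.

End Shift.

(** * Orthogonality of [I^+] and Gorenstein flatness *)

Lemma GP_flat (R : nzRingType) :
  (forall I : lmodType R^c, injective_right I -> GP_perp (charR I)) ->
  forall M : lmodType R, Gorenstein_projective M -> Gorenstein_flat M.
Proof.
move=> perpI M [P [prP isoP homP]]; exists P; split=> // [n|I injI n].
  exact/projective_flat/prP.
apply/tensor_exact_hom; apply: GP_perp_hom_exact => //.
exact: perpI.
Qed.

(** This amounts to [Ext^1(F, I^+) = 0]: as [F^+] is injective, [X^+ -> (ker p)^+] has a section,
    and maps to [I^+] transpose to maps from [I]. *)
Lemma flat_extend (R : nzRingType) (X F : lmodType R) (p : {linear X -> F})
    (I : lmodType R^c) (h : {linear kernel p -> charR I}) :
  flat F -> surjective p ->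
  exists k : {linear X -> charR I}, forall u : kernel p, k (val u) = h u.
Proof.
move=> flF surjp; pose incl : {linear kernel p -> X} := val.
have [pd pdE] := char_dualL p; have [ind indE] := char_dualL incl.
have pdI : injective pd.
  apply: injective_raddf => k kp0; apply: additive_ext => m.
  by have [x <-] := surjp m; rewrite -pdE kp0.
have [r rE] := flat_charL_injective flF (idfun : {linear charL F -> charL F}) pdI.
(* [s] is the section of [X^+ -> (ker p)^+] with values in [ker r]. *)
have [s sE] : exists s : {linear charL (kernel p) -> charL X},
    forall phi, ind (s phi) = phi /\ r (s phi) = 0.
  apply: (@linear_of_graph R^c (charL (kernel p)) (charL X)
    (fun phi x => ind x = phi /\ r x = 0)).
  - move=> phi; have [|x xE] := @QmodZ_extend _ _ incl phi.
      by move=> a /= a0; rewrite (_ : a = 0) ?raddf0//; apply: val_inj.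
    (* Subtracting [pd (r x)] lands in [ker r] without changing the restriction to [ker p]. *)
    exists ((x : charL X) - pd (r x)); split; last by rewrite raddfB /= rE subrr.
    apply: additive_ext => u; rewrite indE /= xE pdE.
    have /eqP -> : p (incl u) == 0 by apply: (valP u).
    by rewrite raddf0 subr0.
  - move=> a phi x phi' x' [<- rx] [<- rx'].
    by rewrite !linearP rx rx' scaler0 addr0.
  - move=> phi x x' [xphi rx] [x'phi rx'].
    apply/eqP; rewrite -subr_eq0; apply/eqP.
    (* [x - x'] vanishes on [ker p], so it is [pd z] for some [z], and [z = r (pd z) = 0]. *)
    have [z zE] : exists z : {additive F -> QmodZ}, forall y, z (p y) = (x - x') y.
      apply: QmodZ_extend => y /eqP y0.
      have -> : y = incl (Kernel (y0 : y \in kernel_pred p)) by [].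
      by rewrite -(indE (x - x')) [ind _]linearB xphi x'phi subrr.
    have zd : pd z = x - x' by apply: additive_ext => y; rewrite pdE zE.
    by rewrite -zd -[z]rE zd linearB rx rx' subrr linear0.
have [hs hsE] := hom_swapLR h; have [k kE] := hom_swapRL (s \o hs).
exists k => u; apply: additive_ext => a.
by rewrite kE /= -[val u]/(incl u) -indE; have [-> _] := sE (hs a); rewrite hsE.
Qed.

(** A cocycle becomes a map on the kernel of a cover of [F_0] and extends by flatness of [F_0];
    exactness of [Hom(-, I^+)] at [F_1] then supplies the correction [g] that turns the extension
    into a map on [P_0]. *)
Lemma Ext1_eq0_flat_resolution (R : nzRingType) (I : lmodType R^c)
    (G F0 F1 F2 : lmodType R) (e : {linear F0 -> G}) (d1 : {linear F1 -> F0})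
    (d2 : {linear F2 -> F1}) :
  flat F0 -> surjective e -> exact_at d1 e ->
  exact_at (tensor_map (idfun : {linear I -> I}) d2)
           (tensor_map (idfun : {linear I -> I}) d1) ->
  (forall x, d1 (d2 x) = 0) ->
  Ext1_eq0 G (charR I).
Proof.
move=> flF0 surje ex1 /tensor_exact_hom homd d12 P h; split; last first.
  move=> [k kh] u; rewrite -kh.
  suff -> : pr_diff P 0 (pr_diff P 1 u) = 0 by rewrite linear0.
  by apply/pr_exactS; exists u.
move=> h0.
have [f0 f0E] := @pr_proj R G P 0 _ _ e (pr_aug P) surje.
(* The cover [P_0 * F_1 -> F_0] replaces the pullback of [P_0 -> G <- F_0]. *)
have [p pE] : exists p : {linear (P 0%N * F1)%type -> F0},
    forall z, p z = f0 z.1 + d1 z.2.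
  have [|p pE] := @linear_pack R (P 0%N * F1)%type F0 (fun z => f0 z.1 + d1 z.2).
    by move=> a z z' /=; rewrite !linearP /= scalerDr addrACA.
  by exists p.
have pS : surjective p.
  move=> y; have [x xE] := pr_aug_surj P (e y).
  have /ex1[u uE] : e (y - f0 x) = 0 by rewrite linearB /= f0E xE subrr.
  by exists (x, u); rewrite pE /= uE addrCA subrr addr0.
pose incl : {linear kernel p -> (P 0%N * F1)%type} := val.
have h_fun x x' : pr_diff P 0 x = pr_diff P 0 x' -> h x = h x'.
  move=> xx'; apply/eqP; rewrite -subr_eq0 -linearB.
  have /pr_exactS[u <-] : pr_diff P 0 (x - x') = 0 by rewrite linearB xx' subrr.
  by rewrite h0.
(* On [ker p] the first component is killed by the augmentation, so it comes from [P_1]; apply [h]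
   to a preimage. *)
have [hL hLE] : exists hL : {linear kernel p -> charR I}, forall u,
    exists x, pr_diff P 0 x = (incl u).1 /\ hL u = h x.
  apply: (@linear_of_graph _ _ _
    (fun u m => exists x, pr_diff P 0 x = (incl u).1 /\ m = h x)).
  - move=> u; have /pr_exact0[x xE] : pr_aug P (incl u).1 = 0.
      rewrite -f0E -[f0 _](addrK (d1 (incl u).2)) -pE.
      have /eqP -> : p (incl u) == 0 by apply: (valP u).
      rewrite sub0r linearN; apply/eqP; rewrite oppr_eq0; apply/eqP/ex1.
      by exists (incl u).2.
    by exists (h x), x.
  - move=> a u m u' m' [x [xE ->]] [x' [xE' ->]].
    by exists (a *: x + x'); rewrite !linearP /= xE xE'.
  - by move=> u m m' [x [xE ->]] [x' [xE' ->]]; apply: h_fun; rewrite xE xE'.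
have [k kE] := flat_extend hL flF0 pS.
have kK x y : f0 (pr_diff P 0 x) + d1 y = 0 -> k (pr_diff P 0 x, y) = h x.
  move=> xy0; have /eqP z0 : p (pr_diff P 0 x, y) = 0 by rewrite pE.
  have := kE (Kernel (z0 : _ \in kernel_pred p)) => /= ->.
  by have [x' [/= /h_fun <- ->]] := hLE (Kernel (z0 : _ \in kernel_pred p)).
have [k2 k2E] : exists k2 : {linear F1 -> charR I}, forall y, k2 y = k (0, y).
  have [|k2 k2E] := @linear_pack R F1 (charR I) (fun y => k (0, y));
    last by exists k2.
  move=> a y y'; rewrite -linearP; congr (k _).
  by congr (_, _); rewrite /= scaler0 addr0.
have [k1 k1E] : exists k1 : {linear P 0%N -> charR I}, forall x, k1 x = k (x, 0).
  have [|k1 k1E] := @linear_pack R (P 0%N) (charR I) (fun x => k (x, 0));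
    last by exists k1.
  move=> a y y'; rewrite -linearP; congr (k _).
  by congr (_, _); rewrite /= scaler0 addr0.
(* [(0, d2 u)] lies in [ker p] and has first component 0, so [k2] vanishes on the image of [d2] and
   factors as [g \o d1]. *)
have /homd[g gE] u : k2 (d2 u) = 0.
  have := kK 0 (d2 u); rewrite !linear0 d12 addr0 => /(_ erefl) k20.
  by rewrite k2E.
(* Write [d] for [pr_diff P 0]. If [f0 (d x) = d1 y], then [(d x, - y)] lies in [ker p], so
   [h x = k1 (d x) - k2 y] with [k2 y = g (f0 (d x))]. *)
have [l lE] : exists l : {linear P 0%N -> charR I}, forall x, l x = k1 x - g (f0 x).
  have [|l lE] := @linear_pack R (P 0%N) (charR I) (fun x => k1 x - g (f0 x)).
    by move=> a x x'; rewrite !linearP /= scalerBr scalerN addrACA.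
  by exists l.
exists l => x; rewrite lE.
have /ex1[y yE] : e (f0 (pr_diff P 0 x)) = 0.
  by rewrite f0E; apply/pr_exact0; exists x.
rewrite -yE gE k1E k2E -linearB /= -(kK x (- y)).
  by congr (k _); congr (_, _); rewrite /= ?subr0 ?sub0r.
by rewrite linearN /= yE subrr.
Qed.

Lemma Gorenstein_flat_Ext1 (R : nzRingType) (G : lmodType R) (I : lmodType R^c) :
  Gorenstein_flat G -> injective_right I -> Ext1_eq0 G (charR I).
Proof.
move=> [F [flF [j [jI jE]] tF]] injI.
have [e eE] : exists e : {linear F (-1) -> G}, forall x, j (e x) = ec_diff F (-1) x.
  apply: (@linear_of_graph _ _ _ (fun x m => j m = ec_diff F (-1) x)).
  - by move=> x; apply/jE; exists x.
  - by move=> a u v u' v' uv uv'; rewrite !linearP uv uv'.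
  - by move=> u v v' uv uv'; apply: jI; rewrite uv uv'.
(* [F_0], [F_1], [F_2] have indices [-1], [-2], [-3]; counting from [-3] makes the differentials
   composable. *)
apply: (@Ext1_eq0_flat_resolution R I G (F (-3 + 1 + 1)) (F (-3 + 1)) (F (-3)) e
  (ec_diff F (-3 + 1)) (ec_diff F (-3))).
- exact: flF.
- move=> m; have /jE[x xE] : exists m', j m' = j m by exists m.
  by exists x; apply: jI; rewrite eE.
- move=> v; rewrite -(@ec_exact R F (-3 + 1) v) -[ec_diff F (-3 + 1 + 1) v]eE.
  by split=> [->|h]; [rewrite linear0|apply: jI; rewrite h linear0].
- exact: tF.
- by move=> x; apply/ec_exact; exists x.
Qed.

Theorem proposition2p8 (R : nzRingType) :
  [<-> forall M : lmodType R, Gorenstein_projective M -> Gorenstein_flat M;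
       forall I : lmodType R^c, injective_right I -> GP_perp (charR I);
       forall F : lmodType R, flat F -> GP_perp (charR (charL F))].
Proof.
tfae.
- by move=> GPF I injI G /GPF GF; apply: Gorenstein_flat_Ext1.
- by move=> perpI F /flat_charL_injective; apply: perpI.
- by move/GP_perp_charR; apply: GP_flat.
Qed.
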